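(* Let $n\in\mathbb{N}$ and let $P\in\mathbf{P}(n)$, that is to say, $P$ is a poset whose underlying set is $[n]=\{1,\ldots,n\}$. Then $$ehr_P(X)=L\Big(\sum_{\emptyset\neq O\in top(P)}ehr_{P_{\mid[n]\setminus O}}(X)\Big),\qquad ehr^{str}_P(X)=L\Big(\sum_{\emptyset\neq O\in top(P),\ O\text{ discrete}}ehr^{str}_{P_{\mid[n]\setminus O}}(X)\Big).$$
   Context: $\mathbb{K}$ is a commutative field of characteristic zero. For a finite poset $P=(A,\leq_P)$, $top(P)$ is the set of open sets of $P$, i.e. subsets $O\subseteq A$ such that ($i\in O$ and $i\leq_Pj$)$\Rightarrow j\in O$; $P_{\mid B}$ is the restriction of $P$ to $B\subseteq A$; an open set $O$ is called discrete if $P_{\mid O}$ is discrete, i.e. $i\leq_Pj$ with $i,j\in O$ implies $i=j$. For $k\geq1$, $L_P(k)$ is the set of maps $f:A\to\{1,\ldots,k\}$ such that $i\leq_Pj\Rightarrow f(i)\leq f(j)$, and $L^{str}_P(k)$ is the set of $f\in L_P(k)$ such that ($i\leq_Pj$ and $f(i)=f(j)$)$\Rightarrow i=j$; for $k=0$, both sets are empty if $A\neq\emptyset$ and have exactly one element if $A=\emptyset$. $ehr_P$ and $ehr_P^{str}\in\mathbb{Q}[X]$ are the unique polynomials such that $ehr_P(k)=\sharp L_P(k)$ and $ehr_P^{str}(k)=\sharp L_P^{str}(k)$ for all $k\geq0$. $L:\mathbb{K}[X]\to\mathbb{K}[X]$ is the linear map defined by $L(H_k(X))=H_{k+1}(X)$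 for all $k\geq0$, where $H_k(X)=\frac{X(X-1)\cdots(X-k+1)}{k!}$.
   Formalization: The case n = 0 is excluded (n ≥ 1 is assumed): for the empty poset both Ehrhart polynomials equal 1 while both sums are empty and L(0) = 0, so the identities fail there. *)

(* Defs.v *)
From HB Require Import structures.
From mathcomp Require Import all_boot all_order all_algebra.

Set Implicit Arguments.
Unset Strict Implicit.
Unset Printing Implicit Defensive.

Import GRing.Theory.

(* The order of a poset is a relation rather than a porderType structure on the
   carrier: the statement ranges over all partial orders on 'I_n, which already
   carries a canonical one. *)
Record poset (A : finType) := Poset {
  pleq :> rel A;
  pleq_refl : reflexive pleq;
  pleq_anti : antisymmetric pleq;
  pleq_trans : transitive pleq }.

Section Restriction.
Variables (A : finType) (P : poset A) (B : {set A}).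

Definition restr_rel : rel {x : A | x \in B} := fun x y => P (val x) (val y).

Lemma restr_refl : reflexive restr_rel.
Proof. by move=> x; apply: pleq_refl. Qed.

Lemma restr_anti : antisymmetric restr_rel.
Proof. by move=> x y /pleq_anti/val_inj. Qed.

Lemma restr_trans : transitive restr_rel.
Proof. by move=> y x z; apply: pleq_trans. Qed.

Definition restr : poset {x : A | x \in B} :=
  Poset restr_refl restr_anti restr_trans.

End Restriction.

Definition discrete_poset (A : finType) (P : poset A) : bool :=
  [forall i, forall j, P i j ==> (i == j)].

Definition top (A : finType) (P : poset A) : {set {set A}} :=
  [set O : {set A} | [forall i, forall j, (i \in O) && P i j ==> (j \in O)]].

(* 'I_k stands for {1, ..., k}; only the order of the values matters. *)
Definition Lset (A : finType) (P : poset A) (k : nat) : {set {ffun A -> 'I_k}} :=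
  [set f : {ffun A -> 'I_k} | [forall i, forall j, P i j ==> (f i <= f j)]].

Definition Lset_str (A : finType) (P : poset A) (k : nat) :
    {set {ffun A -> 'I_k}} :=
  [set f in Lset P k | [forall i, forall j, P i j && (f i == f j) ==> (i == j)]].

Section Counting.
Variables (A : finType) (Q : forall k, pred {ffun A -> 'I_k}).
Hypothesis QP : forall j k (h : 'I_j -> 'I_k), {mono h : x y / x <= y} ->
  forall f : {ffun A -> 'I_j}, Q [ffun a => h (f a)] = Q f.

Let onto j : {set {ffun A -> 'I_j}} := [set f | Q f & f @: setT == setT].

Lemma card_onto k (S : {set 'I_k}) :
  #|[set f : {ffun A -> 'I_k} | Q f & f @: setT == S]| = #|onto #|S| |.
Proof.
pose h (x : 'I_#|S|) : 'I_k := enum_val x.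
have sS : sorted ltn (map val (enum S)).
  apply: (subseq_sorted ltn_trans _ (iota_ltn_sorted 0 k)).
  by rewrite -val_enum_ord map_subseq // [X in subseq _ X]enumT filter_subseq.
have hlt (x y : 'I_#|S|) : x < y -> h x < h y.
  move=> lt; have sz : size (map val (enum S)) = #|S| by rewrite size_map -cardE.
  have := @sorted_ltn_nth _ ltn ltn_trans 0 _ sS x y.
  rewrite !inE sz !ltn_ord => /(_ isT isT lt).
  by rewrite !(nth_map (h x)) -?cardE ?ltn_ord // /h -!(enum_val_nth (h x)).
have hM : {mono h : x y / x <= y}.
  move=> x y; case: (ltngtP x y) => [/hlt/ltnW|/hlt|/val_inj ->] //.
    by rewrite ltnNge => /negbTE.
  by rewrite leqnn.
have hI : injective h by apply: enum_val_inj.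
have hS : h @: setT = S.
  apply/setP=> y; apply/imsetP/idP => [[x _ ->]|yS]; first exact: enum_valP.
  by exists (enum_rank_in yS y); rewrite // /h enum_rankK_in.
pose F (g : {ffun A -> 'I_#|S|}) : {ffun A -> 'I_k} := [ffun a => h (g a)].
have FI : injective F.
  move=> g1 g2 /ffunP e; apply/ffunP => a; apply: hI.
  by have := e a; rewrite !ffunE.
have Fim g : F g @: setT = h @: (g @: setT).
  by rewrite -imset_comp; apply: eq_imset => a; rewrite /F ffunE.
rewrite -(card_imset _ FI); congr #|pred_of_set _|; apply/setP => f.
rewrite inE; apply/andP/imsetP => [[Qf /eqP fS]|[g]]; last first.
  by rewrite inE => /andP[Qg /eqP gT] ->; rewrite QP // Fim gT hS.
have fin a : f a \in S by rewrite -fS imset_f.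
pose g : {ffun A -> 'I_#|S|} := [ffun a => enum_rank_in (fin a) (f a)].
have fE : f = F g by apply/ffunP=> a; rewrite !ffunE /h enum_rankK_in.
exists g => //; rewrite inE -(QP hM) -/(F g) -fE Qf /=.
by rewrite -(inj_eq (imset_inj hI)) -Fim -fE hS fS.
Qed.

Lemma card_count k :
  #|[set f : {ffun A -> 'I_k} | Q f]|
    = \sum_(j < #|A|.+1) 'C(k, j) * #|onto j|.
Proof.
rewrite -sum1dep_card (partition_big (fun f : {ffun A -> 'I_k} => f @: setT) predT) //=.
under eq_bigr => S _ do rewrite sum1dep_card card_onto.
have cA (S : {set 'I_k}) : #|A| < #|S| -> #|onto #|S| | = 0.
  move=> lt; apply: eq_card0 => f; rewrite inE; apply/negP => /andP[_ /eqP fT].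
  have := leq_imset_card f setT; rewrite fT !cardsT card_ord.
  by rewrite leqNgt lt.
rewrite (bigID (fun S : {set 'I_k} => #|S| < #|A|.+1)) /= [X in _ + X]big1 ?addn0;
  last by move=> S; rewrite -leqNgt => /cA.
rewrite (partition_big (fun S : {set 'I_k} => inord #|S| : 'I_#|A|.+1) predT) //=.
apply: eq_bigr => j _.
rewrite (eq_bigl (fun S : {set 'I_k} => #|S| == j)); last first.
  move=> S; apply/andP/eqP => [[lt /eqP <-]|e]; first by rewrite inordK.
  by rewrite e ltn_ord; split=> //; apply/eqP/val_inj; rewrite /= inordK.
rewrite (eq_bigr (fun=> #|onto j|)); last by move=> S /eqP ->.
by rewrite sum_nat_const -cardsE card_draws card_ord.
Qed.

End Counting.

Local Open Scope ring_scope.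

Definition Hpoly (K : fieldType) (k : nat) : {poly K} :=
  (k`!%:R)^-1 *: \prod_(i < k) ('X - (i%:R)%:P).

Section BinomialBasis.
Variable K : fieldType.
Hypothesis hK : [pchar K] =i pred0.

Local Notation H := (Hpoly K).

Let natr_eq0 n : (n%:R == 0 :> K) = (n == 0)%N.
Proof. by have /pcharf0P-> := hK. Qed.

Lemma natr_inj_pchar0 : injective (fun n : nat => n%:R : K).
Proof.
move=> m n /= /eqP; wlog le : m n / (m <= n)%N.
  by move=> IH e; case/orP: (leq_total m n) => le;
     [apply: IH | apply/esym/IH; rewrite // eq_sym].
by rewrite eq_sym -subr_eq0 -natrB // natr_eq0 subn_eq0 => ge;
   apply/eqP; rewrite eqn_leq le.
Qed.

Lemma poly_nat_inj (p q : {poly K}) :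
  (forall n : nat, p.[n%:R] = q.[n%:R]) -> p = q.
Proof.
move=> e; apply/eqP; rewrite -subr_eq0; apply/negPn/negP => nz.
pose rs := [seq n%:R : K | n <- iota 0 (size (p - q)).+1].
have rt : all (root (p - q)) rs.
  by apply/allP => _ /mapP[n _ ->]; rewrite /root !hornerE e subrr.
have u : uniq rs by rewrite map_inj_uniq ?iota_uniq //; apply: natr_inj_pchar0.
by have := max_poly_roots nz rt u; rewrite size_map size_iota ltnNge leqnSn.
Qed.

Lemma Hpoly_nat (k n : nat) : (H k).[n%:R] = 'C(n, k)%:R.
Proof.
have kf : k`!%:R != 0 :> K by rewrite natr_eq0 -lt0n fact_gt0.
apply: (mulfI kf); rewrite -natrM mulnC bin_ffact /Hpoly hornerZ mulVKf //.
rewrite horner_prod; elim: k {kf} => [|k IH]; first by rewrite big_ord0 ffactn0.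
rewrite big_ord_recr /= IH ffactnSr natrM !hornerE.
have [le|lt] := leqP k n; first by rewrite natrB.
by rewrite ffact_small // !mul0r.
Qed.

Lemma Hpoly_coef k : (H k)`_k = (k`!%:R)^-1.
Proof.
rewrite coefZ; have := monic_prod_XsubC (index_enum 'I_k) predT (fun i => i%:R : K).
rewrite monicE lead_coefE size_prod_XsubC /index_enum -enumT size_enum_ord /=.
by rewrite enumT => /eqP ->; rewrite mulr1.
Qed.

Lemma Hpoly_size k : (size (H k) <= k.+1)%N.
Proof.
apply: leq_trans (size_scale_leq _ _) _; rewrite size_prod_XsubC.
by rewrite /index_enum -enumT size_enum_ord.
Qed.

Lemma Hpoly_span n (p : {poly K}) : (size p <= n)%N ->
  exists a : nat -> K, p = \sum_(i < n) a i *: H i.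
Proof.
elim: n p => [|n IH] p sp.
  exists (fun=> 0); rewrite big_ord0; apply/eqP.
  by rewrite -size_poly_eq0 -leqn0.
pose c := p`_n * n`!%:R.
have kf : n`!%:R != 0 :> K by rewrite natr_eq0 -lt0n fact_gt0.
have sr : (size (p - c *: H n)%R <= n)%N.
  apply/leq_sizeP => j; rewrite leq_eqVlt coefB => /predU1P[<-|lt].
    by rewrite coefZ Hpoly_coef mulfK ?subrr.
  rewrite [p`_j](nth_default _ (leq_trans sp lt)) nth_default ?subrr //.
  exact: leq_trans (size_scale_leq _ _) (leq_trans (Hpoly_size n) lt).
have [a pE] := IH _ sr; exists (fun i => if i == n then c else a i).
rewrite big_ord_recr /= eqxx -[LHS](subrK (c *: H n)) pE; congr (_ + _).
by apply: eq_bigr => i _; rewrite ltn_eqF.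
Qed.

Let D (p : {poly K}) : {poly K} := p \Po ('X + 1) - p.

Let D_linear : linear D.
Proof. by move=> a p q; rewrite /D linearP /= scalerBr opprD addrACA. Qed.

Let iterD_linear k : linear (iter k D).
Proof. by elim: k => // k IH a p q; rewrite !iterS IH D_linear. Qed.

Let D0 : D 0 = 0.
Proof. by rewrite /D comp_poly0 subrr. Qed.

Let D_H k : D (H k) = if k is k'.+1 then H k' else 0.
Proof.
apply: poly_nat_inj => n.
rewrite /D hornerD hornerN horner_comp hornerD hornerX (hornerC 1) natr1 !Hpoly_nat.
case: k => [|k]; first by rewrite !bin0 subrr horner0.
by rewrite binS natrD addrAC subrr add0r Hpoly_nat.
Qed.

Let iterD_H k i : (iter k D (H i)).[0] = (i == k)%:R.
Proof.
elim: k i => [|k IH] i /=; first by rewrite -[0](mulr0n 1) Hpoly_nat bin0n eq_sym.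
rewrite -iterS iterSr D_H; case: i => [|i]; last by rewrite IH.
by elim: k {IH} => [|k IH]; rewrite /= ?horner0 // -iterS iterSr D0.
Qed.

Let iterD_sum k n (a : nat -> K) :
  (iter k D (\sum_(i < n) a i *: H i)).[0] = \sum_(i < n) a i * (i == k :> nat)%:R.
Proof.
elim: n => [|n IH].
  by rewrite !big_ord0; elim: k => [|k IH]; rewrite /= ?horner0 // -iterS iterSr D0.
by rewrite !big_ord_recr /= addrC iterD_linear hornerD hornerZ IH iterD_H addrC.
Qed.

Let Lf (p : {poly K}) : {poly K} :=
  \sum_(k < size p) (iter k D p).[0] *: H k.+1.

Let LfE n (p : {poly K}) : (size p <= n)%N ->
  Lf p = \sum_(k < n) (iter k D p).[0] *: H k.+1.
Proof.
move=> le; rewrite /Lf.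
rewrite (big_ord_widen n (fun k => (iter k D p).[0] *: H k.+1)) // big_mkcond /=.
apply: eq_bigr => k _; case: ifPn => //; rewrite -leqNgt => lek.
have [a pE] := Hpoly_span (leqnn (size p)); rewrite {1}pE.
rewrite iterD_sum big1 ?scale0r // => i _.
by rewrite ltn_eqF ?mulr0 // (leq_trans (ltn_ord i)).
Qed.

Let Lf_linear : linear Lf.
Proof.
move=> a p q; pose n := maxn (size p) (size q).
have sp : (size p <= n)%N by apply: leq_maxl.
have sq : (size q <= n)%N by apply: leq_maxr.
rewrite (LfE sp) (LfE sq) (@LfE n); last first.
  rewrite (leq_trans (size_polyD _ _)) // geq_max sq andbT.
  exact: leq_trans (size_scale_leq _ _) sp.
rewrite scaler_sumr -big_split; apply: eq_bigr => k _ /=.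
by rewrite iterD_linear hornerD hornerZ scalerDl scalerA.
Qed.

Lemma Lop_subproof :
  {L : {linear {poly K} -> {poly K}} | forall k, L (H k) = H k.+1}.
Proof.
pose Lm := GRing.isLinear.Build K {poly K} {poly K} _ Lf Lf_linear.
pose L : {linear {poly K} -> {poly K}} := HB.pack Lf Lm.
exists L => k; change (Lf (H k) = H k.+1).
rewrite (LfE (Hpoly_size k)) big_ord_recr /= big1 ?add0r.
  by rewrite iterD_H eqxx scale1r.
by move=> i _; rewrite iterD_H gtn_eqF ?scale0r.
Qed.

Definition Lop : {linear {poly K} -> {poly K}} := sval Lop_subproof.

Lemma Lop_Hpoly k : Lop (H k) = H k.+1.
Proof. exact: (svalP Lop_subproof). Qed.

Lemma Lop_unique (L : {linear {poly K} -> {poly K}}) :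
  (forall k, L (H k) = H k.+1) -> L =1 Lop.
Proof.
move=> LH p; have [a ->] := Hpoly_span (leqnn (size p)).
rewrite !linear_sum; apply: eq_bigr => i _.
by rewrite [LHS]linearZ [RHS]linearZ /= LH Lop_Hpoly.
Qed.

End BinomialBasis.

Lemma pchar_rat0 : [pchar rat] =i pred0.
Proof. exact: Num.Theory.pchar_num. Qed.

Section Ehrhart.
Variables (A : finType) (P : poset A).

Let ehr_of (Q : forall k, pred {ffun A -> 'I_k}) :
  (forall j k (h : 'I_j -> 'I_k), {mono h : x y / (x <= y)%N} ->
    forall f : {ffun A -> 'I_j}, Q _ [ffun a => h (f a)] = Q _ f) ->
  {p : {poly rat} | forall k : nat,
     p.[k%:R] = #|[set f : {ffun A -> 'I_k} | Q _ f]|%:R}.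
Proof.
move=> QP.
exists (\sum_(j < #|A|.+1)
  #|[set f : {ffun A -> 'I_j} | Q _ f & f @: setT == setT]|%:R *: Hpoly rat j).
move=> k; rewrite (card_count QP) horner_sum natr_sum; apply: eq_bigr => j _.
by rewrite hornerZ (Hpoly_nat pchar_rat0) natrM mulrC.
Qed.

Lemma Lset_mono j k (h : 'I_j -> 'I_k) : {mono h : x y / (x <= y)%N} ->
  forall f : {ffun A -> 'I_j}, ([ffun a => h (f a)] \in Lset P k) = (f \in Lset P j).
Proof.
move=> hM f; rewrite !inE; apply: eq_forallb => a; apply: eq_forallb => b.
by rewrite !ffunE hM.
Qed.

Lemma Lset_str_mono j k (h : 'I_j -> 'I_k) : {mono h : x y / (x <= y)%N} ->
  forall f : {ffun A -> 'I_j},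
    ([ffun a => h (f a)] \in Lset_str P k) = (f \in Lset_str P j).
Proof.
move=> hM f; rewrite 2![in LHS]inE 2![in RHS]inE.
have := Lset_mono hM f; rewrite !inE => ->; congr (_ && _).
apply: eq_forallb => a; apply: eq_forallb => b.
rewrite !ffunE; congr (_ && _ ==> _).
by rewrite -!val_eqE /= !eqn_leq !hM.
Qed.

Lemma ehr_subproof :
  {p : {poly rat} | forall k : nat, p.[k%:R] = #|Lset P k|%:R}.
Proof.
have [p pE] := ehr_of (Q := fun k f => f \in Lset P k) Lset_mono.
by exists p => k; rewrite pE cardsE.
Qed.

Lemma ehr_str_subproof :
  {p : {poly rat} | forall k : nat, p.[k%:R] = #|Lset_str P k|%:R}.
Proof.
have [p pE] := ehr_of (Q := fun k f => f \in Lset_str P k) Lset_str_mono.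
by exists p => k; rewrite pE cardsE.
Qed.

Definition ehr : {poly rat} := sval ehr_subproof.
Definition ehr_str : {poly rat} := sval ehr_str_subproof.

Lemma ehrP (k : nat) : ehr.[k%:R] = #|Lset P k|%:R.
Proof. exact: (svalP ehr_subproof). Qed.

Lemma ehr_strP (k : nat) : ehr_str.[k%:R] = #|Lset_str P k|%:R.
Proof. exact: (svalP ehr_str_subproof). Qed.

Lemma ehr_unique (p : {poly rat}) :
  (forall k : nat, p.[k%:R] = #|Lset P k|%:R) -> p = ehr.
Proof. by move=> pE; apply: (poly_nat_inj pchar_rat0) => k; rewrite pE ehrP. Qed.

Lemma ehr_str_unique (p : {poly rat}) :
  (forall k : nat, p.[k%:R] = #|Lset_str P k|%:R) -> p = ehr_str.
Proof. by move=> pE; apply: (poly_nat_inj pchar_rat0) => k; rewrite pE ehr_strP. Qed.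

End Ehrhart.

(* Image in K[X] of a polynomial with rational coefficients. *)
Notation polyK K p := (map_poly (ratr : rat -> K) p).

(* Main.v *)
Require Import Defs.
From HB Require Import structures.
From mathcomp Require Import all_boot all_order all_algebra.

Set Implicit Arguments.
Unset Strict Implicit.
Unset Printing Implicit Defensive.

Import GRing.Theory.
Local Open Scope ring_scope.

(** By Pascal's rule, [H_{k+1}(X+1) - H_{k+1}(X) = H_k(X)], and
    [H_{k+1}(0) = 0].  Hence [Lop] is discrete integration: [Lop q] is the
    polynomial that vanishes at 0 and whose forward difference is [q]
    ([Lop_antidifference]).  As a polynomial over a field of characteristic
    zero is determined by its values at the natural numbers, both identities
    amount to the recurrence

      c(0) = 0,   c(k+1) - c(k) = the sum over nonempty O of d_O(k)

    between the counting functions of the (strict) labellings of [P] and of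
    its restrictions ([polyK_eq_Lop]).

    For the recurrence, sort the labellings [f] of [P] with values in
    [{1, ..., k+1}] by their top level [O], the set where [f] takes the value
    [k+1].  Monotonicity makes [O] open, and strictness makes it discrete.
    Conversely, given such an [O], the labellings with top level [O] are the
    labellings of the complement of [O] with values in [{1, ..., k}], extended
    by [k+1] on [O] ([card_top_level], [extend_max_Lset],
    [extend_max_Lset_str]).  The contribution of the empty [O] is [c(k)], which
    is the term that moves to the left-hand side; [c(0) = 0] because the poset
    is nonempty. *)

(** * Integer-valued rational polynomials in characteristic zero *)

Section RationalScalars.
Variables (K : fieldType) (hK : [pchar K] =i pred0).

Lemma intr_eq0_pchar0 (z : int) : (z%:~R == 0 :> K) = (z == 0).
Proof.
have natE n : (n%:R == 0 :> K) = (n == 0)%N by have /pcharf0P-> := hK.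
by case: z => n; rewrite ?NegzE ?mulrNz ?oppr_eq0 -pmulrn natE.
Qed.

(** [ratr] is defined on reduced fractions; knowing its value on every
    fraction is what makes its compatibility with sums and products a
    computation. *)
Lemma ratr_frac (a b : int) : b != 0 ->
  ratr (a%:~R / b%:~R) = a%:~R / b%:~R :> K.
Proof.
move=> b0; set x : rat := a%:~R / b%:~R.
have bK : b%:~R != 0 :> K by rewrite intr_eq0_pchar0.
have dK : (denq x)%:~R != 0 :> K by rewrite intr_eq0_pchar0 denq_eq0.
have bQ : b%:~R != 0 :> rat by rewrite intr_eq0.
apply/eqP; rewrite /ratr eqr_div // -!intrM; apply/eqP; congr _%:~R.
apply: (@intr_inj rat).
by rewrite !intrM numqE /x mulrAC divfK.
Qed.

Lemma ratr_zmod_morphism_pchar0 : zmod_morphism (ratr : rat -> K).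
Proof.
move=> x y; have dx := denq_neq0 x; have dy := denq_neq0 y.
rewrite -{1}[x]divq_num_den -{1}[y]divq_num_den.
rewrite -mulNr addf_div ?intr_eq0 // -mulrNz -!intrM -intrD.
rewrite ratr_frac ?mulf_neq0 // /ratr -mulNr addf_div ?intr_eq0_pchar0 //.
by rewrite intrD !intrM mulrNz.
Qed.

Lemma ratr_monoid_morphism_pchar0 : monoid_morphism (ratr : rat -> K).
Proof.
split=> [|x y]; first by rewrite (ratr_int K 1).
have dx := denq_neq0 x; have dy := denq_neq0 y.
rewrite -{1}[x]divq_num_den -{1}[y]divq_num_den mulf_div -!intrM.
by rewrite ratr_frac ?mulf_neq0 // /ratr mulf_div -!intrM.
Qed.

(** The change of scalars packaged as a morphism, with the property used
    below: over both fields, the natural values at natural numbers agree. *)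
Lemma polyK_rmorphism :
  {phi : {rmorphism {poly rat} -> {poly K}} |
    (forall p, phi p = polyK K p) &
    forall p (k m : nat), p.[k%:R] = m%:R -> (phi p).[k%:R] = m%:R}.
Proof.
pose add := GRing.isZmodMorphism.Build _ _ _ ratr_zmod_morphism_pchar0.
pose mul := GRing.isMonoidMorphism.Build _ _ _ ratr_monoid_morphism_pchar0.
pose phi : {rmorphism rat -> K} := HB.pack (ratr : rat -> K) add mul.
exists (map_poly phi) => // p k m pk.
by rewrite -(rmorph_nat phi k) horner_map pk rmorph_nat.
Qed.

(** On the basis [Hpoly], the two conditions are Pascal's rule and
    ['C(0, i.+1) = 0], so that [Lop hK q] satisfies them, and they determine
    all the values of [p] at natural numbers. *)
Lemma Lop_antidifference (p q : {poly K}) : p.[0] = 0 ->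
  (forall k : nat, p.[k.+1%:R] = p.[k%:R] + q.[k%:R]) -> p = Lop hK q.
Proof.
move=> p0 pS.
have LS r (k : nat) : (Lop hK r).[k.+1%:R] = (Lop hK r).[k%:R] + r.[k%:R].
  have [a ->] := Hpoly_span hK (leqnn (size r)).
  rewrite linear_sum !horner_sum -big_split; apply: eq_bigr => i _ /=.
  rewrite linearZ /= Lop_Hpoly 3![(_ *: Hpoly _ _).[_]]hornerZ !(Hpoly_nat hK).
  by rewrite binS natrD mulrDr.
have L0 r : (Lop hK r).[0] = 0.
  have [a ->] := Hpoly_span hK (leqnn (size r)).
  rewrite linear_sum horner_sum big1 // => i _.
  by rewrite linearZ /= Lop_Hpoly [LHS]hornerZ (Hpoly_nat hK _ 0) ?mulr0.
apply: (poly_nat_inj hK); elim=> [|k IH]; first by rewrite p0 L0.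
by rewrite pS LS IH.
Qed.

(** Reduces an identity between Ehrhart polynomials to a recurrence between
    cardinals. *)
Lemma polyK_eq_Lop (I : finType) (S : pred I) (p : {poly rat})
    (q : I -> {poly rat}) (c : nat -> nat) (d : I -> nat -> nat) :
  (forall k : nat, p.[k%:R] = (c k)%:R) ->
  (forall i (k : nat), (q i).[k%:R] = (d i k)%:R) ->
  c 0%N = 0%N -> (forall k, c k.+1 = c k + \sum_(i | S i) d i k)%N ->
  polyK K p = Lop hK (\sum_(i | S i) polyK K (q i)).
Proof.
move=> pE qE c0 cS; have [phi phiE phi_nat] := polyK_rmorphism.
rewrite -phiE; under eq_bigr do rewrite -phiE.
apply: Lop_antidifference => [|k]; first by rewrite (phi_nat p 0 0) // pE c0.
rewrite !(phi_nat _ _ _ (pE _)) cS natrD horner_sum natr_sum; congr (_ + _).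
by apply: eq_bigr => i _; rewrite (phi_nat _ _ _ (qE _ _)).
Qed.

End RationalScalars.

Local Open Scope nat_scope.

(** * Top levels of labellings *)

Section PosetViews.
Variables (A : finType) (P : poset A).

Lemma topP (O : {set A}) :
  reflect (forall i j, i \in O -> P i j -> j \in O) (O \in top P).
Proof.
rewrite inE; apply: (iffP forallP) => [h i j iO Pij|h i].
  by have /forallP/(_ j) := h i; rewrite iO Pij.
by apply/forallP => j; apply/implyP => /andP[]; apply: h.
Qed.

Lemma LsetP k (f : {ffun A -> 'I_k}) :
  reflect (forall i j, P i j -> f i <= f j) (f \in Lset P k).
Proof.
rewrite inE; apply: (iffP forallP) => [h i j|h i].
  by move: j; apply/forall_inP/h.
by apply/forall_inP/h.
Qed.

Lemma Lset_strP k (f : {ffun A -> 'I_k}) :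
  reflect (f \in Lset P k /\ forall i j, P i j -> f i = f j -> i = j)
          (f \in Lset_str P k).
Proof.
rewrite [f \in Lset_str _ _]in_set; apply: (iffP andP) => -[fL h]; split=> //.
  move=> i j Pij /eqP fij; apply/eqP; move/forallP/(_ i)/forallP/(_ j): h.
  by rewrite Pij fij.
apply/forallP => i; apply/forallP => j; apply/implyP => /andP[Pij /eqP fij].
exact/eqP/h.
Qed.

Lemma discrete_restrP (O : {set A}) :
  reflect {in O &, forall i j, P i j -> i = j} (discrete_poset (restr P O)).
Proof.
apply: (iffP forallP) => [h i j iO jO Pij|h [i iO]].
  have /forallP/(_ (Sub j jO))/implyP := h (Sub i iO).
  by move/(_ Pij)/eqP/(congr1 val).
apply/forall_inP => -[j jO] Pij; apply/eqP/val_inj; exact: h.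
Qed.

End PosetViews.

Definition top_level (A : finType) k (f : {ffun A -> 'I_k.+1}) : {set A} :=
  f @^-1: [set ord_max].

Lemma top_levelE (A : finType) k (f : {ffun A -> 'I_k.+1}) a :
  (a \in top_level f) = (f a == ord_max).
Proof. by rewrite !inE. Qed.

Section TopLevel.
Variables (A : finType) (P : poset A).

Lemma top_level_open k f : f \in Lset P k.+1 -> top_level f \in top P.
Proof.
move=> /LsetP fM; apply/topP => i j; rewrite !top_levelE => /eqP fi /fM.
by rewrite fi -val_eqE eqn_leq /= leq_ord => ->.
Qed.

Lemma top_level_discrete k f :
  f \in Lset_str P k.+1 -> discrete_poset (restr P (top_level f)).
Proof.
move=> /Lset_strP[_ fI]; apply/discrete_restrP => i j.
rewrite !top_levelE => /eqP fi /eqP fj /fI; apply; exact: etrans fi _.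
Qed.

(** The complement of [O] is given as the range of an injection [e] rather than
    as the subtype: with [e] the identity, the case [O = set0] compares
    labellings of [P] with [k.+1] and [k] values, without any transport along
    an isomorphism between [P] and its restriction to the full set. *)
Section Extension.
Variables (T : finType) (Q : poset T) (O : {set A}) (e : T -> A).
Hypothesis e_inj : injective e.
Hypothesis e_range : forall a, (a \in codom e) = (a \notin O).
Hypothesis eP : forall s t, Q s t = P (e s) (e t).

Definition extend_max k (g : {ffun T -> 'I_k}) : {ffun A -> 'I_k.+1} :=
  [ffun a => if [pick t | e t == a] is Some t then lift ord_max (g t)
             else ord_max].

Let e_notin t : e t \notin O.
Proof. by rewrite -e_range codom_f. Qed.

Lemma extend_max_e k (g : {ffun T -> 'I_k}) t :
  extend_max g (e t) = lift ord_max (g t).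
Proof.
rewrite ffunE; case: pickP => [s /eqP/e_inj -> //|/(_ t)].
by rewrite eqxx.
Qed.

Lemma extend_max_O k (g : {ffun T -> 'I_k}) a :
  a \in O -> extend_max g a = ord_max.
Proof.
move=> aO; rewrite ffunE; case: pickP => // t /eqP ta.
by have := e_notin t; rewrite ta aO.
Qed.

Let eltP a : a \in O \/ exists t, a = e t.
Proof.
case: (boolP (a \in O)) => [|]; first by left.
by rewrite -e_range => /codomP; right.
Qed.

Lemma extend_max_inj k : injective (@extend_max k).
Proof.
move=> g1 g2 /ffunP eg; apply/ffunP => t; apply: (@lift_inj _ ord_max).
by rewrite -!extend_max_e.
Qed.

Lemma top_level_extend_max k (g : {ffun T -> 'I_k}) :
  top_level (extend_max g) = O.
Proof.
apply/setP => a; rewrite top_levelE; have [aO|[t ->]] := eltP a.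
  by rewrite extend_max_O // eqxx aO.
by rewrite extend_max_e eq_sym (negPf (neq_lift _ _)) (negPf (e_notin t)).
Qed.

Lemma extend_max_onto k (f : {ffun A -> 'I_k.+1}) :
  top_level f = O -> exists g, f = extend_max g.
Proof.
move=> fO; have lt t : f (e t) < k.
  have := e_notin t; rewrite -fO top_levelE -val_eqE /=.
  by rewrite ltn_neqAle leq_ord andbT.
exists [ffun t => Ordinal (lt t)]; apply/ffunP => a.
have [aO|[t ->]] := eltP a.
  by rewrite extend_max_O //; apply/eqP; rewrite -top_levelE fO.
by rewrite extend_max_e ffunE; apply: ord_inj; rewrite lift_max.
Qed.

(** The map [extend_max e] is a bijection onto the labellings with top level
    [O]; [S] and [S'] are the same kind of labellings of the two posets. *)
Lemma card_top_level k (S : {set {ffun A -> 'I_k.+1}})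
    (S' : {set {ffun T -> 'I_k}}) :
  (forall g, (extend_max g \in S) = (g \in S')) ->
  #|[set f in S | top_level f == O]| = #|S'|.
Proof.
move=> SS'; rewrite -(card_imset _ (@extend_max_inj k)).
apply: eq_card => f; rewrite inE.
apply/andP/imsetP => [[fS /eqP/extend_max_onto[g fE]]|[g gS ->]].
  by exists g; rewrite // -SS' -fE.
by rewrite SS' gS top_level_extend_max.
Qed.

Hypothesis O_open : O \in top P.

(** The relations not already present in [Q] have an end in [O].  If it is the
    upper end, its label is the greatest one; if only the lower end were in
    [O], then [O] would not be open. *)
Lemma extend_max_Lset k (g : {ffun T -> 'I_k}) :
  (extend_max g \in Lset P k.+1) = (g \in Lset Q k).
Proof.
apply/LsetP/LsetP => gM i j.
  by rewrite eP => /gM; rewrite !extend_max_e !lift_max.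
have [jO|[t ->]] := eltP j; first by rewrite (extend_max_O _ jO); rewrite -ltnS ltn_ord.
have [iO|[s ->]] := eltP i.
  by move/(topP _ _ O_open _ _ iO); rewrite (negPf (e_notin t)).
by rewrite -eP !extend_max_e !lift_max; apply: gM.
Qed.

(** A relation between two elements with equal labels stays inside [O], where
    discreteness excludes it unless it is trivial, or outside, where [g]
    decides. *)
Lemma extend_max_Lset_str k (g : {ffun T -> 'I_k}) :
  discrete_poset (restr P O) ->
  (extend_max g \in Lset_str P k.+1) = (g \in Lset_str Q k).
Proof.
move=> /discrete_restrP O_disc.
apply/Lset_strP/Lset_strP; rewrite extend_max_Lset => -[gL gI]; split=> // i j.
  rewrite eP => Pij gij; apply/e_inj/gI => //.
  by rewrite !extend_max_e gij.
have [iO|[s ->]] := eltP i.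
  by move=> Pij _; apply: O_disc (Pij) => //; apply: (topP _ _ O_open _ _ iO Pij).
have [jO|[t ->]] := eltP j.
  rewrite extend_max_e (extend_max_O _ jO) => _ /eqP.
  by rewrite eq_sym (negPf (neq_lift _ _)).
by rewrite -eP !extend_max_e => Qst /lift_inj/(gI _ _ Qst) ->.
Qed.

End Extension.

(** * The recurrence on the number of labels *)

(** The empty top level is counted apart: labellings that avoid the greatest
    value are those with one value less. *)
Lemma card_by_top_level k (S : {set {ffun A -> 'I_k.+1}}) (D : pred {set A})
    (m : nat) (d : {set A} -> nat) :
  (forall f, f \in S -> D (top_level f)) -> D set0 ->
  #|[set f in S | top_level f == set0]| = m ->
  (forall O, D O -> #|[set f in S | top_level f == O]| = d O) ->
  #|S| = m + \sum_(O | D O && (O != set0)) d O.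
Proof.
move=> SD D0 Sm Sd; rewrite -sum1_card (partition_big (@top_level A k) D) //=.
rewrite (bigD1 set0) //=; congr (_ + _); first by rewrite sum1dep_card.
by apply: eq_bigr => O /andP[DO _]; rewrite sum1dep_card Sd.
Qed.

Lemma card_Lset0 : 0 < #|A| -> #|Lset P 0| = 0.
Proof. by case/card_gt0P=> a _; apply: eq_card0 => f; case: (f a). Qed.

Lemma card_Lset_str0 : 0 < #|A| -> #|Lset_str P 0| = 0.
Proof. by case/card_gt0P=> a _; apply: eq_card0 => f; case: (f a). Qed.

Lemma set0_open : set0 \in top P.
Proof. by apply/topP => i j; rewrite inE. Qed.

Lemma set0_discrete : discrete_poset (restr P set0).
Proof. by apply/discrete_restrP => i j; rewrite inE. Qed.

Let codom_id (a : A) : (a \in codom id) = (a \notin set0).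
Proof. by rewrite inE; apply/codomP; exists a. Qed.

Let codom_val (O : {set A}) (a : A) :
  (a \in codom (val : {x | x \in ~: O} -> A)) = (a \notin O).
Proof.
rewrite -in_setC; apply/codomP/idP => [[x ->]|aO]; first exact: (valP x).
by exists (Sub a aO).
Qed.

Lemma card_LsetS k :
  #|Lset P k.+1| = #|Lset P k| +
    \sum_(O in top P | O != set0) #|Lset (restr P (~: O)) k|.
Proof.
apply: (card_by_top_level (D := fun O => O \in top P)) => [f|||O O_open].
- exact: top_level_open.
- exact: set0_open.
- apply: (card_top_level (@inj_id A) codom_id) => g.
  by apply: (extend_max_Lset (@inj_id A) codom_id _ set0_open).
- apply: (card_top_level val_inj (codom_val O)) => g.
  by apply: (extend_max_Lset val_inj (codom_val O)).
Qed.

Lemma card_Lset_strS k :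
  #|Lset_str P k.+1| = #|Lset_str P k| +
    \sum_(O in top P | (O != set0) && discrete_poset (restr P O))
      #|Lset_str (restr P (~: O)) k|.
Proof.
pose D O := (O \in top P) && discrete_poset (restr P O).
rewrite (eq_bigl (fun O => D O && (O != set0))); last first.
  by move=> O; rewrite /D -andbA [_ && (O != _)]andbC.
apply: card_by_top_level => [f fS|||O /andP[O_open O_disc]].
- rewrite /D top_level_discrete // top_level_open //.
  by have /Lset_strP[] := fS.
- by rewrite /D set0_open set0_discrete.
- apply: (card_top_level (@inj_id A) codom_id) => g.
  apply: (extend_max_Lset_str (@inj_id A) codom_id _ set0_open) => //.
  exact: set0_discrete.
- apply: (card_top_level val_inj (codom_val O)) => g.
  by apply: (extend_max_Lset_str val_inj (codom_val O)).
Qed.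

End TopLevel.

Local Open Scope ring_scope.

Theorem proposition25 (K : fieldType) (hK : [pchar K] =i pred0)
    (n : nat) (hn : (0 < n)%N) (P : poset 'I_n) :
  polyK K (ehr P) =
    Lop hK (\sum_(O in top P | O != set0) polyK K (ehr (restr P (~: O))))
  /\
  polyK K (ehr_str P) =
    Lop hK (\sum_(O in top P | (O != set0) && discrete_poset (restr P O))
              polyK K (ehr_str (restr P (~: O)))).
Proof.
have n_gt0 : (0 < #|'I_n|)%N by rewrite card_ord.
split.
  apply: (polyK_eq_Lop hK (d := fun O k => #|Lset (restr P (~: O)) k|)).
  - exact: ehrP.
  - by move=> O k; apply: ehrP.
  - exact: card_Lset0.
  - exact: card_LsetS.
apply: (polyK_eq_Lop hK (d := fun O k => #|Lset_str (restr P (~: O)) k|)).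
- exact: ehr_strP.
- by move=> O k; apply: ehr_strP.
- exact: card_Lset_str0.
- exact: card_Lset_strS.
Qed.
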